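(* Let $\mathcal C,\mathcal M,\mathcal N$ be categories and let $I:\mathcal M\to\mathcal C$, $M:\mathcal C\to\mathcal M$, $N:\mathcal C\to\mathcal N$, $J:\mathcal N\to\mathcal C$ be functors with adjunctions $N\dashv J$ (unit $\theta:1_{\mathcal C}\to JN$, counit $\rho:NJ\to 1_{\mathcal N}$) and $I\dashv M$ (unit $\sigma:1_{\mathcal M}\to MI$, counit $\psi:IM\to 1_{\mathcal C}$). Let $\eta:1_{\mathcal M}\to MJNI$ and $\epsilon:NIMJ\to 1_{\mathcal N}$ be the unit and counit of the composite adjunction $NI\dashv MJ$, i.e. $\eta_x=(M\theta_{Ix})\circ\sigma_x$ for each object $x$ of $\mathcal M$ and $\epsilon_y=\rho_y\circ(N\psi_{Jy})$ for each object $y$ of $\mathcal N$. The following conditions are equivalent: (i) for each object $x$ of $\mathcal M$, $(x,\theta_{Ix})$ is a final object in the comma category $I\downarrow JNIx$; (ii) $NI$ is full and faithful; (iii) $\eta$ is a natural isomorphism. If $I$ is full and faithful, then (i)--(iii) are equivalent to (iv) $M\theta_{Ix}$ is an isomorphism in $\mathcal M$ for each object $x$ of $\mathcal M$. Similarly, the following conditions are equivalent: (v) for each object $y$ of $\mathcal N$, $(y,\psi_{Jy})$ is an initial object in the comma category $IMJy\downarrow J$; (vi) $MJ$ is full and faithful; (vii) $\epsilon$ is a natural isomorphism. If $J$ is full and faithful, then (v)--(vii) are equivalent to (viii) $N\psi_{Jy}$ is an isomorphism in $\mathcal N$ for each object $y$ of $\mathcal N$.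
   Context: For a functor $G:\mathcal D\to\mathcal C$ and an object $c$ of $\mathcal C$: the comma category $c\downarrow G$ has as objects pairs $(y,f)$ with $y\in\mathcal D$ and $f:c\to Gy$ in $\mathcal C$, and a morphism $h:(y,f)\to(z,g)$ is $h:y\to z$ in $\mathcal D$ with $(Gh)\circ f=g$. Dually, $G\downarrow c$ has as objects pairs $(y,f)$ with $f:Gy\to c$, and a morphism $h:(y,f)\to(z,g)$ is $h:y\to z$ in $\mathcal D$ with $g\circ(Gh)=f$. *)

(* Defs.v *)
From mathcomp Require Import all_boot.
From Stdlib Require Import ProofIrrelevance.

Set Implicit Arguments.
Unset Strict Implicit.
Unset Printing Implicit Defensive.

Declare Scope cat_scope.
Delimit Scope cat_scope with cat.
Local Open Scope cat_scope.

(* Arrows are compared by Leibniz equality, so [Hom x y] is a plain type (set)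
   of arrows and not a setoid.  No size restriction is imposed. *)
Record Category := MkCategory {
  Ob :> Type;
  Hom : Ob -> Ob -> Type;
  idm : forall x, Hom x x;
  comp : forall x y z, Hom y z -> Hom x y -> Hom x z;
  comp_idl : forall x y (f : Hom x y), comp (idm y) f = f;
  comp_idr : forall x y (f : Hom x y), comp f (idm x) = f;
  comp_assoc : forall w x y z (h : Hom y z) (g : Hom x y) (f : Hom w x),
    comp h (comp g f) = comp (comp h g) f
}.

Arguments Hom {c} x y.
Arguments idm {c} x.
Arguments comp {c x y z} g f : rename.

Notation "g ∘ f" := (comp g f) (at level 40, left associativity) : cat_scope.

Definition is_iso (C : Category) (x y : C) (f : Hom x y) : Prop :=
  exists g : Hom y x, g ∘ f = idm x /\ f ∘ g = idm y.

Definition initial_object (C : Category) (a : C) : Prop :=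
  forall x : C, exists f : Hom a x, forall g : Hom a x, g = f.

Definition final_object (C : Category) (a : C) : Prop :=
  forall x : C, exists f : Hom x a, forall g : Hom x a, g = f.

Record Functor (C D : Category) := MkFunctor {
  fobj :> C -> D;
  fmap : forall x y : C, Hom x y -> Hom (fobj x) (fobj y);
  fmap_id : forall x, fmap (idm x) = idm (fobj x);
  fmap_comp : forall x y z (g : Hom y z) (f : Hom x y),
    fmap (g ∘ f) = fmap g ∘ fmap f
}.

Arguments fmap {C D} F {x y} f : rename.

Definition full (C D : Category) (F : Functor C D) : Prop :=
  forall (x y : C) (g : Hom (F x) (F y)), exists f : Hom x y, fmap F f = g.

Definition faithful (C D : Category) (F : Functor C D) : Prop :=
  forall (x y : C) (f g : Hom x y), fmap F f = fmap F g -> f = g.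

Definition full_and_faithful (C D : Category) (F : Functor C D) : Prop :=
  full F /\ faithful F.

Definition functor_id (C : Category) : Functor C C :=
  @MkFunctor C C (fun x => x) (fun _ _ f => f)
    (fun _ => erefl) (fun _ _ _ _ _ => erefl).

Section FunctorComp.
Variables (C D E : Category) (G : Functor D E) (F : Functor C D).

Fact functor_comp_id (x : C) : fmap G (fmap F (idm x)) = idm (G (F x)).
Proof. by rewrite !fmap_id. Qed.

Fact functor_comp_comp (x y z : C) (g : Hom y z) (f : Hom x y) :
  fmap G (fmap F (g ∘ f)) = fmap G (fmap F g) ∘ fmap G (fmap F f).
Proof. by rewrite !fmap_comp. Qed.

Definition functor_comp : Functor C E :=
  @MkFunctor C E (fun x => G (F x)) (fun _ _ f => fmap G (fmap F f))
    functor_comp_id functor_comp_comp.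
End FunctorComp.

Record NatTrans (C D : Category) (F G : Functor C D) := MkNatTrans {
  component :> forall x : C, Hom (F x) (G x);
  naturality : forall (x y : C) (f : Hom x y),
    component y ∘ fmap F f = fmap G f ∘ component x
}.

Definition natural_isomorphism (C D : Category) (F G : Functor C D)
    (t : NatTrans F G) : Prop :=
  forall x : C, is_iso (t x).

(* F is left adjoint to G, with the given unit and counit: the two triangle
   identities hold. *)
Definition is_adjunction (C D : Category) (F : Functor C D) (G : Functor D C)
    (unit : NatTrans (functor_id C) (functor_comp G F))
    (counit : NatTrans (functor_comp F G) (functor_id D)) : Prop :=
  (forall x : C, counit (F x) ∘ fmap F (unit x) = idm (F x)) /\
  (forall y : D, fmap G (counit y) ∘ unit (G y) = idm (G y)).

Section CompositeAdjunction.
Variables (A B C : Category).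
Variables (F : Functor A B) (G : Functor B A).
Variables (F' : Functor B C) (G' : Functor C B).
Variables (unit : NatTrans (functor_id A) (functor_comp G F)).
Variables (counit : NatTrans (functor_comp F G) (functor_id B)).
Variables (unit' : NatTrans (functor_id B) (functor_comp G' F')).
Variables (counit' : NatTrans (functor_comp F' G') (functor_id C)).

Fact composite_unit_natural (x y : A) (f : Hom x y) :
  (fmap G (unit' (F y)) ∘ unit y) ∘ f =
  fmap G (fmap G' (fmap F' (fmap F f))) ∘ (fmap G (unit' (F x)) ∘ unit x).
Proof.
rewrite -comp_assoc (naturality unit f) /= !comp_assoc -!fmap_comp.
by rewrite (naturality unit' (fmap F f)).
Qed.

Definition composite_unit :
    NatTrans (functor_id A)
             (functor_comp (functor_comp G G') (functor_comp F' F)) :=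
  @MkNatTrans A A (functor_id A)
    (functor_comp (functor_comp G G') (functor_comp F' F))
    (fun x => fmap G (unit' (F x)) ∘ unit x) composite_unit_natural.

Fact composite_counit_natural (x y : C) (f : Hom x y) :
  (counit' y ∘ fmap F' (counit (G' y)))
    ∘ fmap F' (fmap F (fmap G (fmap G' f))) =
  f ∘ (counit' x ∘ fmap F' (counit (G' x))).
Proof.
rewrite -comp_assoc -fmap_comp (naturality counit (fmap G' f)) /= fmap_comp.
by rewrite !comp_assoc (naturality counit' f).
Qed.

Definition composite_counit :
    NatTrans (functor_comp (functor_comp F' F) (functor_comp G G'))
             (functor_id C) :=
  @MkNatTrans C C (functor_comp (functor_comp F' F) (functor_comp G G'))
    (functor_id C)
    (fun y => counit' y ∘ fmap F' (counit (G' y))) composite_counit_natural.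

Fact composite_adjunction :
  is_adjunction unit counit -> is_adjunction unit' counit' ->
  is_adjunction composite_unit composite_counit.
Proof.
move=> [t1 t2] [t1' t2']; split=> [x|y] /=.
- have /= e := naturality counit (unit' (F x)).
  rewrite -comp_assoc -fmap_comp (fmap_comp F) comp_assoc e.
  by rewrite -comp_assoc t1 comp_idr t1'.
- have /= e := naturality unit' (counit (G' y)).
  rewrite comp_assoc -fmap_comp (fmap_comp G') -comp_assoc -e.
  by rewrite comp_assoc t2' comp_idl t2.
Qed.
End CompositeAdjunction.

(* [comma_under c G] is c ↓ G and [comma_over G c] is G ↓ c.  Arrows of a comma
   category are arrows of D bundled with a proof
   of the commutation condition; proof irrelevance makes two of them equal as
   soon as the underlying arrows of D are. *)
Section CommaUnder.
Variables (D C : Category) (c : C) (G : Functor D C).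

Record comma_under_ob := MkUnder {
  under_ob : D;
  under_arrow : Hom c (G under_ob)
}.

Definition comma_under_hom (a b : comma_under_ob) : Type :=
  {h : Hom (under_ob a) (under_ob b) | fmap G h ∘ under_arrow a = under_arrow b}.

Fact comma_under_hom_eq (a b : comma_under_ob) (h k : comma_under_hom a b) :
  proj1_sig h = proj1_sig k -> h = k.
Proof.
by case: h k => [h ph] [k pk] /= e; subst k; rewrite (proof_irrelevance _ ph pk).
Qed.

Fact comma_under_id_subproof (a : comma_under_ob) :
  fmap G (idm (under_ob a)) ∘ under_arrow a = under_arrow a.
Proof. by rewrite fmap_id comp_idl. Qed.

Fact comma_under_comp_subproof (a b d : comma_under_ob)
    (k : comma_under_hom b d) (h : comma_under_hom a b) :
  fmap G (proj1_sig k ∘ proj1_sig h) ∘ under_arrow a = under_arrow d.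
Proof. by rewrite fmap_comp -comp_assoc (proj2_sig h) (proj2_sig k). Qed.

Definition comma_under_id (a : comma_under_ob) : comma_under_hom a a :=
  exist _ (idm (under_ob a)) (comma_under_id_subproof a).

Definition comma_under_comp (a b d : comma_under_ob)
    (k : comma_under_hom b d) (h : comma_under_hom a b) : comma_under_hom a d :=
  exist _ (proj1_sig k ∘ proj1_sig h) (comma_under_comp_subproof k h).

Fact comma_under_idl (a b : comma_under_ob) (h : comma_under_hom a b) :
  comma_under_comp (comma_under_id b) h = h.
Proof. by apply: comma_under_hom_eq; apply: comp_idl. Qed.

Fact comma_under_idr (a b : comma_under_ob) (h : comma_under_hom a b) :
  comma_under_comp h (comma_under_id a) = h.
Proof. by apply: comma_under_hom_eq; apply: comp_idr. Qed.

Fact comma_under_assoc (a b d e : comma_under_ob) (l : comma_under_hom d e)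
    (k : comma_under_hom b d) (h : comma_under_hom a b) :
  comma_under_comp l (comma_under_comp k h) =
  comma_under_comp (comma_under_comp l k) h.
Proof. by apply: comma_under_hom_eq; apply: comp_assoc. Qed.

Definition comma_under : Category :=
  @MkCategory comma_under_ob comma_under_hom comma_under_id comma_under_comp
    comma_under_idl comma_under_idr comma_under_assoc.
End CommaUnder.

Section CommaOver.
Variables (D C : Category) (G : Functor D C) (c : C).

Record comma_over_ob := MkOver {
  over_ob : D;
  over_arrow : Hom (G over_ob) c
}.

Definition comma_over_hom (a b : comma_over_ob) : Type :=
  {h : Hom (over_ob a) (over_ob b) | over_arrow b ∘ fmap G h = over_arrow a}.

Fact comma_over_hom_eq (a b : comma_over_ob) (h k : comma_over_hom a b) :
  proj1_sig h = proj1_sig k -> h = k.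
Proof.
by case: h k => [h ph] [k pk] /= e; subst k; rewrite (proof_irrelevance _ ph pk).
Qed.

Fact comma_over_id_subproof (a : comma_over_ob) :
  over_arrow a ∘ fmap G (idm (over_ob a)) = over_arrow a.
Proof. by rewrite fmap_id comp_idr. Qed.

Fact comma_over_comp_subproof (a b d : comma_over_ob)
    (k : comma_over_hom b d) (h : comma_over_hom a b) :
  over_arrow d ∘ fmap G (proj1_sig k ∘ proj1_sig h) = over_arrow a.
Proof. by rewrite fmap_comp comp_assoc (proj2_sig k) (proj2_sig h). Qed.

Definition comma_over_id (a : comma_over_ob) : comma_over_hom a a :=
  exist _ (idm (over_ob a)) (comma_over_id_subproof a).

Definition comma_over_comp (a b d : comma_over_ob)
    (k : comma_over_hom b d) (h : comma_over_hom a b) : comma_over_hom a d :=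
  exist _ (proj1_sig k ∘ proj1_sig h) (comma_over_comp_subproof k h).

Fact comma_over_idl (a b : comma_over_ob) (h : comma_over_hom a b) :
  comma_over_comp (comma_over_id b) h = h.
Proof. by apply: comma_over_hom_eq; apply: comp_idl. Qed.

Fact comma_over_idr (a b : comma_over_ob) (h : comma_over_hom a b) :
  comma_over_comp h (comma_over_id a) = h.
Proof. by apply: comma_over_hom_eq; apply: comp_idr. Qed.

Fact comma_over_assoc (a b d e : comma_over_ob) (l : comma_over_hom d e)
    (k : comma_over_hom b d) (h : comma_over_hom a b) :
  comma_over_comp l (comma_over_comp k h) =
  comma_over_comp (comma_over_comp l k) h.
Proof. by apply: comma_over_hom_eq; apply: comp_assoc. Qed.

Definition comma_over : Category :=
  @MkCategory comma_over_ob comma_over_hom comma_over_id comma_over_comp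
    comma_over_idl comma_over_idr comma_over_assoc.
End CommaOver.

Arguments MkUnder {D C c G} under_ob under_arrow.
Arguments MkOver {D C G c} over_ob over_arrow.

(* Main.v *)
(* The adjunction N ⊣ J turns an arrow I z → JNI x into an arrow NI z → NI x,
   and under it composition with theta corresponds to the action of NI, because
   theta_{Ix} ∘ I h = JNI h ∘ theta_{Iz}; so finality of (x, theta_{Ix}) for all x
   is full faithfulness of NI.  The latter amounts to invertibility of the unit,
   as for every left adjoint.  If I is full and faithful then sigma is
   invertible, and eta_x = M theta_{Ix} ∘ sigma_x is invertible iff M theta_{Ix}
   is.  The second half is the first one read in the opposite categories, where
   J^op ⊣ N^op and M^op ⊣ I^op. *)

Require Import Defs.
From mathcomp Require Import all_boot.

Set Implicit Arguments.
Unset Strict Implicit.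
Unset Printing Implicit Defensive.

Local Open Scope cat_scope.

Section Isomorphisms.
Variables (C : Category) (x y z : C).

Lemma is_iso_comp (g : Hom y z) (f : Hom x y) :
  is_iso g -> is_iso f -> is_iso (g ∘ f).
Proof.
move=> [g' [g'g gg']] [f' [f'f ff']]; exists (f' ∘ g'); split.
- by rewrite comp_assoc -(comp_assoc f') g'g comp_idr.
- by rewrite comp_assoc -(comp_assoc g) ff' comp_idr.
Qed.

Lemma is_iso_cancel_r (g : Hom y z) (f : Hom x y) :
  is_iso f -> is_iso (g ∘ f) -> is_iso g.
Proof.
move=> [f' [f'f ff']] [h [hgf gfh]]; exists (f ∘ h); split.
(* Composing [f ∘ h ∘ g] on the right with [f ∘ f'] makes [h ∘ (g ∘ f)] appear, which cancels. *)
- rewrite -[LHS]comp_idr -ff' comp_assoc -(comp_assoc _ g) -(comp_assoc f).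
  by rewrite hgf comp_idr.
- by rewrite comp_assoc.
Qed.
End Isomorphisms.

Section Adjunctions.
Variables (C D : Category) (F : Functor C D) (G : Functor D C).
Variables (unit : NatTrans (functor_id C) (functor_comp G F)).
Variables (counit : NatTrans (functor_comp F G) (functor_id D)).
Hypothesis adj : is_adjunction unit counit.

(** The transpose is undone by [c ↦ counit y ∘ fmap F c], by naturality of [counit] and the first
    triangle identity. *)
Lemma adjunct_inj (x : C) (y : D) (a b : Hom (F x) y) :
  fmap G a ∘ unit x = fmap G b ∘ unit x -> a = b.
Proof.
have counitK (c : Hom (F x) y) : counit y ∘ fmap F (fmap G c ∘ unit x) = c.
  rewrite fmap_comp comp_assoc (naturality counit c) /= -comp_assoc.
  by rewrite (proj1 adj) comp_idr.
by move=> e; rewrite -(counitK a) e counitK.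
Qed.

Lemma adjunct_surj (x : C) (y : D) (g : Hom x (G y)) :
  fmap G (counit y ∘ fmap F g) ∘ unit x = g.
Proof.
rewrite fmap_comp -comp_assoc -(naturality unit g) /= comp_assoc.
by rewrite (proj2 adj) comp_idl.
Qed.

Lemma full_and_faithful_unit_iso :
  full_and_faithful F <-> natural_isomorphism unit.
Proof.
split=> [[fullF faithF] x | iso_unit].
(* The triangle identity makes [counit (F x)] a left inverse of [fmap F (unit x)], so its preimage
   under [F] is the candidate inverse. *)
- have [h Fh] := fullF _ _ (counit (F x)); exists h; split.
  + by apply: faithF; rewrite fmap_comp Fh (proj1 adj) fmap_id.
  + by rewrite (naturality unit h) /= Fh (proj2 adj).
split=> [x y g | x y f f' e]; have [k [ku uk]] := iso_unit y.
(* The transpose of [g] lands in [G (F y)]; the inverse [k] of [unit y] brings it back to [y]. *)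
- exists (k ∘ fmap G g ∘ unit x); apply: adjunct_inj.
  rewrite -(naturality unit) /= !comp_assoc uk.
  by rewrite comp_idl.
(* Naturality recovers [f] from its image as [k ∘ fmap G (fmap F f) ∘ unit x]. *)
- have /= nf := naturality unit f; have /= nf' := naturality unit f'.
  by rewrite -(comp_idl f) -(comp_idl f') -ku -!comp_assoc nf nf' e.
Qed.

Lemma final_unit_full_and_faithful (B : Category) (I : Functor B C) :
  (forall x : B,
     final_object (C := comma_over I (G (F (I x)))) (MkOver x (unit (I x))))
  <-> full_and_faithful (functor_comp F I).
Proof.
split=> [fin | [fullFI faithFI] x [z g]].
- split=> [z x g | z x f f' e].
  (* The arrow to the final object from the transpose of [g] is the preimage of [g]. *)
  + have [[h /= hE] _] := fin x (MkOver z (fmap G g ∘ unit (I z))).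
    by exists h; apply: adjunct_inj; rewrite -hE (naturality unit (fmap I h)).
  (* Both [f] and [f'] underlie arrows from this one object to the final object. *)
  + have [k kP] := fin x (MkOver z (unit (I x) ∘ fmap I f)).
    have f'E : unit (I x) ∘ fmap I f' = unit (I x) ∘ fmap I f.
      rewrite (naturality unit (fmap I f)) (naturality unit (fmap I f')) /=.
      by congr (fmap G _ ∘ _).
    have := etrans (kP (exist _ f erefl)) (esym (kP (exist _ f' f'E))).
    by move/(congr1 (@proj1_sig _ _)).
(* The required [h] is a preimage of the arrow whose transpose is [g]. *)
- have [h /= hE] := fullFI _ _ (counit (F (I x)) ∘ fmap F g).
  have hP : unit (I x) ∘ fmap I h = g.
    by rewrite (naturality unit (fmap I h)) /= hE adjunct_surj.
  exists (exist _ h hP) => -[k /= kP]; apply: comma_over_hom_eq => /=.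
  apply: faithFI; apply: adjunct_inj => /=.
  by rewrite -(naturality unit (fmap I h)) -(naturality unit (fmap I k)) hP.
Qed.
End Adjunctions.

Lemma composite_unit_conditions
    (A B C : Category) (I : Functor A B) (M : Functor B A)
    (N : Functor B C) (J : Functor C B)
    (theta : NatTrans (functor_id B) (functor_comp J N))
    (rho : NatTrans (functor_comp N J) (functor_id C))
    (sigma : NatTrans (functor_id A) (functor_comp M I))
    (psi : NatTrans (functor_comp I M) (functor_id B)) :
  is_adjunction theta rho -> is_adjunction sigma psi ->
  let cond_i := forall x : A,
    final_object (C := comma_over I (J (N (I x)))) (MkOver x (theta (I x))) in
  let cond_ii := full_and_faithful (functor_comp N I) in
  let cond_iii := natural_isomorphism (composite_unit sigma theta) in
  let cond_iv := forall x : A, is_iso (fmap M (theta (I x))) in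
  [/\ cond_i <-> cond_ii, cond_ii <-> cond_iii
    & full_and_faithful I -> (cond_iii <-> cond_iv)].
Proof.
move=> adjNJ adjIM cond_i cond_ii cond_iii cond_iv; split.
- exact: final_unit_full_and_faithful adjNJ _ _.
- exact: full_and_faithful_unit_iso (composite_adjunction adjIM adjNJ).
- move=> /(full_and_faithful_unit_iso adjIM) iso_sigma; split=> iso x.
  + exact: is_iso_cancel_r (iso_sigma x) (iso x).
  + exact: is_iso_comp (iso x) (iso_sigma x).
Qed.

Definition op (C : Category) : Category :=
  @MkCategory C (fun x y => Hom y x) (@idm C) (fun _ _ _ g f => f ∘ g)
    (fun _ _ f => comp_idr f) (fun _ _ f => comp_idl f)
    (fun _ _ _ _ h g f => esym (comp_assoc f g h)).

Definition op_functor (C D : Category) (F : Functor C D) :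
    Functor (op C) (op D) :=
  @MkFunctor (op C) (op D) F (fun _ _ f => fmap F f)
    (fun x => fmap_id F x) (fun _ _ _ g f => fmap_comp F f g).

(* The type mentions [functor_id (op D)] rather than [op_functor (functor_id D)]:
   the two differ in their proof fields, and [is_adjunction] expects the
   former. *)
Definition op_counit (C D : Category) (F : Functor C D) (G : Functor D C)
    (counit : NatTrans (functor_comp F G) (functor_id D)) :
    NatTrans (functor_id (op D)) (functor_comp (op_functor F) (op_functor G)) :=
  @MkNatTrans (op D) (op D) (functor_id (op D))
    (functor_comp (op_functor F) (op_functor G))
    (fun y => counit y) (fun _ _ f => esym (naturality counit f)).

Definition op_unit (C D : Category) (F : Functor C D) (G : Functor D C)
    (unit : NatTrans (functor_id C) (functor_comp G F)) :
    NatTrans (functor_comp (op_functor G) (op_functor F)) (functor_id (op C)) :=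
  @MkNatTrans (op C) (op C) (functor_comp (op_functor G) (op_functor F))
    (functor_id (op C))
    (fun x => unit x) (fun _ _ f => esym (naturality unit f)).

Lemma op_adjunction (C D : Category) (F : Functor C D) (G : Functor D C)
    (unit : NatTrans (functor_id C) (functor_comp G F))
    (counit : NatTrans (functor_comp F G) (functor_id D)) :
  is_adjunction unit counit -> is_adjunction (op_counit counit) (op_unit unit).
Proof. by move=> [t1 t2]; split=> x; [apply: t2 | apply: t1]. Qed.

Lemma op_is_iso (C : Category) (x y : C) (f : Hom x y) :
  is_iso (C := op C) (x := y) (y := x) f <-> is_iso f.
Proof. by split=> -[g [gf fg]]; exists g. Qed.

Lemma op_full_and_faithful (C D : Category) (F : Functor C D) :
  full_and_faithful (op_functor F) <-> full_and_faithful F.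
Proof.
by split=> -[fullF faithF]; split=> x y; [apply: fullF | apply: faithF
  | apply: fullF | apply: faithF].
Qed.

(** Passing to opposites only reverses composition, so both sides involve the same underlying arrows
    and convertible commutation conditions. *)
Lemma op_initial_comma_under (C D : Category) (c : C) (G : Functor D C)
    (y : D) (f : Hom c (G y)) :
  final_object (C := comma_over (op_functor G) (c : op C))
    (MkOver (D := op D) (C := op C) (G := op_functor G) y f)
  <-> initial_object (C := comma_under c G) (MkUnder y f).
Proof.
split=> univ [z g].
- exact: univ (MkOver (D := op D) (C := op C) (G := op_functor G) z g).
- exact (univ (MkUnder (D := D) (C := C) (c := c) (G := G) z g)).
Qed.

Theorem theorem3p1
  (CC MM NN : Category)
  (I : Functor MM CC) (M : Functor CC MM) (N : Functor CC NN) (J : Functor NN CC)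
  (theta : NatTrans (functor_id CC) (functor_comp J N))
  (rho : NatTrans (functor_comp N J) (functor_id NN))
  (adjNJ : is_adjunction theta rho)
  (sigma : NatTrans (functor_id MM) (functor_comp M I))
  (psi : NatTrans (functor_comp I M) (functor_id CC))
  (adjIM : is_adjunction sigma psi) :
  let eta : NatTrans (functor_id MM)
              (functor_comp (functor_comp M J) (functor_comp N I)) :=
    composite_unit sigma theta in
  let epsilon : NatTrans (functor_comp (functor_comp N I) (functor_comp M J))
              (functor_id NN) :=
    composite_counit psi rho in
  let cond_i := forall x : MM,
    final_object (C := comma_over I (J (N (I x)))) (MkOver x (theta (I x))) in
  let cond_ii := full_and_faithful (functor_comp N I) in
  let cond_iii := natural_isomorphism eta in
  let cond_iv := forall x : MM, is_iso (fmap M (theta (I x))) in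
  let cond_v := forall y : NN,
    initial_object (C := comma_under (I (M (J y))) J) (MkUnder y (psi (J y))) in
  let cond_vi := full_and_faithful (functor_comp M J) in
  let cond_vii := natural_isomorphism epsilon in
  let cond_viii := forall y : NN, is_iso (fmap N (psi (J y))) in
  [/\ [<-> cond_i; cond_ii; cond_iii],
      full_and_faithful I -> [<-> cond_i; cond_ii; cond_iii; cond_iv],
      [<-> cond_v; cond_vi; cond_vii]
    & full_and_faithful J -> [<-> cond_v; cond_vi; cond_vii; cond_viii] ].
Proof.
move=> eta epsilon cond_i cond_ii cond_iii cond_iv.
move=> cond_v cond_vi cond_vii cond_viii.
have [i_ii ii_iii iii_iv] := composite_unit_conditions adjNJ adjIM.
(* Here the opposites of [J], [N], [M], [I] stand for [I], [M], [N], [J], with [psi] as [theta] and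
   [rho] as [sigma]; the composite unit becomes [epsilon]. *)
have [v_vi vi_vii vii_viii] :=
  composite_unit_conditions (op_adjunction adjIM) (op_adjunction adjNJ).
have {}v_vi : cond_v <-> cond_vi.
  split=> [v | /op_full_and_faithful/v_vi v y].
  - by apply/op_full_and_faithful/v_vi => y; apply/op_initial_comma_under/v.
  - by apply/op_initial_comma_under/v.
have {}vi_vii : cond_vi <-> cond_vii.
  split=> [/op_full_and_faithful/vi_vii iso y | iso].
  - by apply/op_is_iso/iso.
  - by apply/op_full_and_faithful/vi_vii => y; apply/op_is_iso/iso.
have {}vii_viii : full_and_faithful J -> (cond_vii <-> cond_viii).
  move=> /op_full_and_faithful/vii_viii [to_viii to_vii].
  split=> iso y; apply/op_is_iso.
  - by apply: to_viii => z; apply/op_is_iso/iso.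
  - by apply: to_vii => z; apply/op_is_iso/iso.
split=> [|/iii_iv ?||/vii_viii ?]; tfae; tauto.
Qed.
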